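(* The system $\mathbf L_C$ of classical propositional logics and, for every set $V$ of variables, the system $\mathbf L_{FOL}(V)$ of first-order logics have the patchwork property of models.
   Context: $\mathbf L_C=\langle\mathcal{CPL}(P): P\in\mathrm{Sig}\rangle$ with $\mathrm{Sig}$ the class of sets containing no proper terms over $\{\wedge,\neg,\bot\}$; $\mathcal{CPL}(P)$ has connectives $\wedge,\neg,\bot$, atomic formulas $P$, models $\mathfrak M:P\to\{0,1\}$ extended to formulas classically, $\mathrm{mng}_{\mathfrak M}(\phi)=\mathfrak M(\phi)$, $\mathfrak M\models\phi$ iff $\mathfrak M(\phi)=1$. First-order logic $\mathcal{FOL}_t(V)$ for a relational similarity type $t$ (arities $\ge1$) and variable set $V$: atomic formulas $P_t(V)=\{r(v_1,\dots,v_n):r\in\mathrm{dom}(t),t(r)=n,v_i\in V\}$; connectives $\wedge$, $\neg$, $\exists v$ ($v\in V$), constants $\bot$ and $v=w$ ($v,w\in V$); models are $t$-structures $\mathfrak M$ with universe $M$; $\mathrm{mng}_{\mathfrak M}(\phi)=\{h\in{}^VM:\mathfrak M\models\phi[h]\}$; $\mathfrak M\models\phi$ iff $\phi$ holds under all assignments. For nonempty $V$, $\mathrm{Sig}(V)=\{P_t(V): t$ a nonempty relational similarity type$\}$ (each $P_t(V)$ determines $t$) and $\mathbf L_{FOL}(V)=\langle\mathcal{FOL}_t(V):P_t(V)\in\mathrm{Sig}(V)\rangle$; for $V=\emptyset$, $\mathrm{Sig}(\emptyset)=\{\emptyset\}$ and $\mathbf L_{FOL}(\emptyset)$ consists of $\mathcal{FOL}_\emptyset(\emptyset)$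 only. For a system $\mathbf L=\langle\mathcal L^P:P\in\mathrm{Sig}\rangle$ of logics (with formula algebras $\mathfrak F^P$, universes $F^P$, model classes $M^P$, meaning functions $\mathrm{mng}^P$; $F^{R}$ for $R\subseteq P$ denotes the subalgebra of formulas built from $R$): the patchwork property of models holds if whenever $P_i\in\mathrm{Sig}$ ($i\in I$), $P=\bigcup_iP_i\in\mathrm{Sig}$, and $\mathfrak M_i\in M^{P_i}$ satisfy $\mathrm{mng}^{P_i}_{\mathfrak M_i}\upharpoonright F^{P_i\cap P_j}=\mathrm{mng}^{P_j}_{\mathfrak M_j}\upharpoonright F^{P_i\cap P_j}$ for all $i,j$ with $F^{P_i\cap P_j}\ne\emptyset$, there is $\mathfrak M\in M^P$ with $\mathrm{mng}^P_{\mathfrak M}\upharpoonright F^{P_i}=\mathrm{mng}^{P_i}_{\mathfrak M_i}$ for all $i\in I$. *)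

(* Defs.v *)
From mathcomp Require Import all_boot.
From mathcomp Require Import boolp classical_sets.

Set Implicit Arguments.
Unset Strict Implicit.
Unset Printing Implicit Defensive.

Local Open Scope classical_set_scope.

(* Terms over the connectives [C], of arities [ar], with generators in [A].
   Generators are kept apart from proper terms by the constructor [Atom], so
   that no set of generators contains a proper term. *)
Inductive term (C : Type) (ar : C -> nat) (A : Type) : Type :=
| Atom of A
| Op (c : C) of ('I_(ar c) -> term ar A).

Arguments Atom {C ar A}.
Arguments Op {C ar A}.

(* The universe F^R of the subalgebra generated by R.  It is empty when R is
   empty and there is no constant among the connectives. *)
Inductive formulas (C : Type) (ar : C -> nat) (A : Type) (R : set A) :
    set (term ar A) :=
| formulas_atom a : R a -> formulas R (Atom a)
| formulas_op c (args : 'I_(ar c) -> term ar A) :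
    (forall i, formulas R (args i)) -> formulas R (Op c args).

(* A system < L^P : P in Sig > of logics.  All signatures are sets of elements
   of one type [atom], so that unions and intersections of signatures and
   inclusions of formula algebras make sense.  The formula algebra of L^P has
   universe [formulas P]; the values of [mng P] and [valid P] outside
   [formulas P] carry no information. *)
Record logic_system : Type := LogicSystem {
  atom : Type;
  conn : Type;
  arity : conn -> nat;
  meaning : Type;
  Sig : set (set atom);
  model : set atom -> Type;
  mng : forall P : set atom, model P -> term arity atom -> meaning;
  valid : forall P : set atom, model P -> term arity atom -> Prop
}.

Arguments arity : clear implicits.
Arguments Sig : clear implicits.
Arguments model : clear implicits.
Arguments mng {l P}.
Arguments valid {l P}.

Definition patchwork_property (L : logic_system) : Prop :=
  forall (I : Type) (P_ : I -> set (atom L)) (M_ : forall i, model L (P_ i)),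
    (forall i, Sig L (P_ i)) ->
    Sig L (\bigcup_i P_ i) ->
    (forall i j,
       @formulas _ (arity L) _ (P_ i `&` P_ j) !=set0 ->
       forall phi, formulas (P_ i `&` P_ j) phi ->
         mng (M_ i) phi = mng (M_ j) phi) ->
    exists M : model L (\bigcup_i P_ i),
      forall i phi, formulas (P_ i) phi -> mng M phi = mng (M_ i) phi.

Section ClassicalPropositionalLogic.
Variable A : Type.

Inductive cpl_conn : Type := CAnd | CNot | CBot.

Definition cpl_arity (c : cpl_conn) : nat :=
  match c with CAnd => 2 | CNot => 1 | CBot => 0 end.

Definition cpl_op (c : cpl_conn) : ('I_(cpl_arity c) -> bool) -> bool :=
  match c with
  | CAnd => fun b => b ord0 && b ord_max
  | CNot => fun b => ~~ b ord0
  | CBot => fun=> false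
  end.

Definition cpl_model (P : set A) : Type := {p : A | P p} -> bool.

Fixpoint cpl_val (P : set A) (M : cpl_model P) (phi : term cpl_arity A) :
    bool :=
  match phi with
  | Atom p => if pselect (P p) is left Pp then M (exist _ p Pp) else false
  | Op c args => cpl_op (fun i => cpl_val M (args i))
  end.

Definition L_C : logic_system := {|
  Sig := setT;
  model := cpl_model;
  mng := cpl_val;
  valid := fun P M phi => cpl_val M phi = true
|}.

End ClassicalPropositionalLogic.

(* [Rel] is the type from which relation symbols are drawn; a similarity type
   is a partial function from it to the positive natural numbers. *)
Record simtype (Rel : Type) : Type := SimType {
  rank :> Rel -> option nat;
  rank_gt0 : forall r n, rank r = Some n -> 0 < n
}.

Definition dom (Rel : Type) (t : simtype Rel) : set Rel :=
  [set r | exists n, t r = Some n].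

(* Universes are nonempty subsets of a fixed type [U], so that meanings in
   different structures, with different universes, can be compared. *)
Record structure (Rel U : Type) (t : simtype Rel) : Type := Structure {
  univ : set U;
  univ_neq0 : univ !=set0;
  interp : forall r n, t r = Some n -> set (n.-tuple U);
  interp_univ : forall r n (e : t r = Some n) (x : n.-tuple U),
    interp e x -> forall k, univ (tnth x k)
}.

Section FirstOrderLogic.
Variables (V Rel U : Type).

(* The pair (r, [:: v_1; ...; v_n]) is the atomic formula r(v_1, ..., v_n). *)
Definition fol_atom : Type := (Rel * seq V)%type.

(* The set P_t(V). *)
Definition fol_atoms (t : simtype Rel) : set fol_atom :=
  [set a | t a.1 = Some (size a.2)].

Inductive fol_conn : Type :=
| FAnd | FNot | FEx of V | FBot | FEq of V & V.

Definition fol_arity (c : fol_conn) : nat :=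
  match c with FAnd => 2 | FNot => 1 | FEx _ => 1 | FBot => 0 | FEq _ _ => 0 end.

Definition update (h : V -> U) (v : V) (a : U) : V -> U :=
  fun w => if `[< w = v >] then a else h w.

Definition sat_op (D : set U) (c : fol_conn) :
    ('I_(fol_arity c) -> (V -> U) -> Prop) -> (V -> U) -> Prop :=
  match c with
  | FAnd => fun S h => S ord0 h /\ S ord_max h
  | FNot => fun S h => ~ S ord0 h
  | FEx v => fun S h => exists2 a, D a & S ord0 (update h v a)
  | FBot => fun _ _ => False
  | FEq v w => fun _ h => h v = h w
  end.

Fixpoint sat (t : simtype Rel) (M : structure U t)
    (phi : term fol_arity fol_atom) : (V -> U) -> Prop :=
  match phi with
  | Atom (r, vs) => fun h =>
      exists e : t r = Some (size vs), interp M e (map_tuple h (in_tuple vs))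
  | Op c args => sat_op (univ M) (fun i => sat M (args i))
  end.

Definition assignment (t : simtype Rel) (M : structure U t) : set (V -> U) :=
  [set h | forall v, univ M (h v)].

Definition fol_mng (t : simtype Rel) (M : structure U t)
    (phi : term fol_arity fol_atom) : set (V -> U) :=
  [set h | assignment M h /\ sat M phi h].

Definition fol_valid (t : simtype Rel) (M : structure U t)
    (phi : term fol_arity fol_atom) : Prop :=
  forall h, assignment M h -> sat M phi h.

(* The similarity types t for which FOL_t(V) belongs to the system: the
   nonempty ones if V is nonempty, and only the empty one otherwise. *)
Definition admissible (t : simtype Rel) : Prop :=
  (inhabited V -> dom t !=set0) /\ (~ inhabited V -> dom t = set0).

Definition fol_Sig : set (set fol_atom) :=
  [set P | exists2 t, admissible t & P = fol_atoms t].

(* Models for the signature P are the t-structures, for the t (unique among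
   the admissible types) such that P = P_t(V). *)
Record fol_model (P : set fol_atom) : Type := FolModel {
  fol_type : simtype Rel;
  fol_type_adm : admissible fol_type;
  fol_typeP : P = fol_atoms fol_type;
  fol_structure :> structure U fol_type
}.

Definition L_FOL : logic_system := {|
  Sig := fol_Sig;
  model := fol_model;
  mng := fun P (M : fol_model P) => fol_mng M;
  valid := fun P (M : fol_model P) => fol_valid M
|}.

End FirstOrderLogic.

(* Main.v *)
From mathcomp Require Import all_boot.
From mathcomp Require Import boolp classical_sets.
Require Import Defs.

(** A model of the union is obtained by declaring an atom true as soon as it is
    true in one of the given models; agreement on [F^(P_i `&` P_j)] makes this
    independent of the model in which the atom is evaluated, and the meanings of
    compound formulas follow by induction.  In the first-order case the
    universes coincide when there is a variable [v], because the formula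
    [v = v] means the set of all assignments.  Without variables there are neither
    atoms nor quantifiers, and every structure gives the same meanings. *)

Set Implicit Arguments.
Unset Strict Implicit.
Unset Printing Implicit Defensive.

Local Open Scope classical_set_scope.

Lemma cpl_val_agree (A : Type) (P Q R : set A) (M : cpl_model P)
    (N : cpl_model Q) :
  (forall p, R p -> cpl_val M (Atom p) = cpl_val N (Atom p)) ->
  forall phi, formulas R phi -> cpl_val M phi = cpl_val N phi.
Proof.
move=> MN phi; elim=> [p /MN //|c args _ IH] /=.
by congr cpl_op; apply/funext.
Qed.

(** Atoms outside [P] get the default value [false]. Hence an atom true in [M_ j] lies in [P_ j],
    which puts it in the intersection where agreement applies. *)
Lemma cpl_val_atom_mem (A : Type) (P : set A) (M : cpl_model P) (p : A) :
  cpl_val M (Atom p) -> P p.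
Proof. by move=> /=; case: pselect. Qed.

Lemma L_C_patchwork (A : Type) : patchwork_property (L_C A).
Proof.
move=> I P_ M_ _ _ /= agree.
exists (fun p => `[< exists i, cpl_val (M_ i) (Atom (sval p)) >]) => i.
apply: cpl_val_agree => p Pip.
rewrite [LHS]/=; case: pselect => [Pp|]; last by case; exists i.
apply/asboolP/idP => /= [[j Mjp]|Mip]; last by exists i.
have Pjp := cpl_val_atom_mem Mjp.
have ijp : @formulas _ cpl_arity _ (P_ i `&` P_ j) (Atom p).
  exact: formulas_atom.
by rewrite [is_true _](congr1 is_true (agree i j (ex_intro _ _ ijp) _ ijp)).
Qed.

(** Only quantifiers look at the universe, and each one supplies the variable that
    [V -> univ M = univ N] asks for. Updating with a witness from the universe stays within
    assignments. *)
Lemma sat_agree (V Rel U : Type) (t t' : simtype Rel) (M : structure U t)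
    (N : structure U t') (R : set (fol_atom V Rel)) :
  (V -> univ M = univ N) ->
  (forall a, R a -> forall h : V -> U, assignment N h ->
     sat M (Atom a) h <-> sat N (Atom a) h) ->
  forall phi, formulas R phi -> forall h, assignment N h ->
    sat M phi h <-> sat N phi h.
Proof.
move=> eqU MN phi; elim=> [a /MN //|c args _ IH] h hN.
case: c args IH => [||v||v w] args IH //=.
- by rewrite !(propext (IH _ _ hN)).
- by rewrite !(propext (IH _ _ hN)).
- rewrite (eqU v).
  by split=> -[a Na sa]; exists a => //; apply/(IH _ (update h v a));
    rewrite // /update => w; case: asboolP.
Qed.

(** Constant assignments recover the universe. *)
Lemma assignment_univ (V Rel U : Type) (t t' : simtype Rel)
    (M : structure U t) (N : structure U t') :
  V -> @assignment V _ _ _ M = @assignment V _ _ _ N -> univ M = univ N.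
Proof.
move=> v MN; apply/seteqP; split=> a Da.
- suff /(_ v) : @assignment V _ _ _ N (fun=> a) by [].
  by rewrite -MN => w.
- suff /(_ v) : @assignment V _ _ _ M (fun=> a) by [].
  by rewrite MN => w.
Qed.

(** Since [v = v] is a constant of the logic, it belongs to [formulas R] even for empty [R], so
    disjoint signatures are covered too. *)
Lemma agree_univ (V Rel U : Type) (t t' : simtype Rel) (M : structure U t)
    (N : structure U t') (R : set (fol_atom V Rel)) :
  (@formulas _ (@fol_arity V) _ R !=set0 ->
   forall phi, formulas R phi -> fol_mng M phi = fol_mng N phi) ->
  V -> univ M = univ N.
Proof.
move=> agree v; apply: (assignment_univ v).
have z : 'I_0 -> term (@fol_arity V) (fol_atom V Rel) by case.
have Rvv : formulas R (Op (ar := @fol_arity V) (FEq v v) z).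
  by apply: formulas_op => -[].
have mngE s (S : structure U s) :
    fol_mng S (Op (ar := @fol_arity V) (FEq v v) z) = assignment S.
  by apply/seteqP; split=> h; [case|].
by rewrite -!mngE; apply: (agree (ex_intro _ _ Rvv)).
Qed.

Lemma L_FOL_patchwork (V Rel U : Type) :
  inhabited U -> patchwork_property (L_FOL V Rel U).
Proof.
move=> [u] I P_ M_ _ [t t_adm Pt] /= agree.
have univE i j : V -> univ (M_ i) = univ (M_ j) by exact: agree_univ (agree i j).
(* Any member of the family provides the universe; for an empty family, [u] makes a nonempty one. *)
have [D D0 DE] : exists2 D : set U, D !=set0 & forall i, V -> D = univ (M_ i).
  have [[i0]|noI] := pselect (inhabited I).
    by exists (univ (M_ i0)); [exact: univ_neq0|move=> i; exact: univE].
  by exists [set u]; [exists u|move=> i; case: noI].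
pose int r n (_ : t r = Some n) : set (n.-tuple U) := [set x |
  (forall k, D (tnth x k)) /\
  exists i (e : fol_type (M_ i) r = Some n), interp (M_ i) e x].
have int_univ r n (e : t r = Some n) (x : n.-tuple U) :
    int r n e x -> forall k, D (tnth x k) by case.
pose S := Structure D0 int_univ.
exists (FolModel t_adm Pt S) => i phi Piphi.
have asgE : @assignment V _ _ _ S = assignment (M_ i).
  apply/seteqP; split=> h hD v; first by rewrite -(DE i v); exact: hD.
  by rewrite /= (DE i v); exact: hD.
suff satE h : assignment (M_ i) h -> sat S phi h <-> sat (M_ i) phi h.
  rewrite /= /fol_mng asgE.
  by apply/seteqP; split=> h [hM sh]; split=> //; apply/(satE h hM).
apply: sat_agree Piphi h; first exact: DE.
move=> [r vs] Pia h hM; split=> [[_ [_ [j [ej xj]]]]|[ei xi]].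
(* The equation [ej] says that [r] has the right arity in the type of [M_ j], so the atom is in
   [P_ j] as well. *)
- have ija : @formulas _ (@fol_arity V) _ (P_ i `&` P_ j) (Atom (r, vs)).
    by apply: formulas_atom; split=> //; rewrite (fol_typeP (M_ j)).
  have hj : fol_mng (M_ j) (Atom (r, vs)) h.
    by split; [move=> v; rewrite (univE j i v); exact: hM|exists ej].
  by move: hj; rewrite -(agree i j (ex_intro _ _ ija) _ ija) => -[].
- have e : t r = Some (size vs).
    suff : fol_atoms t (r, vs) by [].
    by rewrite -Pt; exists i.
  exists e; split; last by exists i, ei.
  (* The variable required by [DE] is the [k]-th entry of [vs]. *)
  by move=> k; rewrite tnth_map (DE i (tnth (in_tuple vs) k)); exact: hM.
Qed.

Theorem theorem5p2 :
  (forall A : Type, patchwork_property (L_C A)) /\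
  (forall V Rel U : Type, inhabited U -> patchwork_property (L_FOL V Rel U)).
Proof. by split; [exact: L_C_patchwork|exact: L_FOL_patchwork]. Qed.
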